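(* Let $A\in\mathbb{H}^{m\times n}$, let $I\subset\{1,\dots,m\}$ and $J\subset\{1,\dots,n\}$ be index sets of cardinality $k$, let $C=A[:,J]\in\mathbb{H}^{m\times k}$, let $B=A[I,J]\in\mathbb{H}^{k\times k}$ be nonsingular, and set $A_{\rm CUR}=CB^{-1}A[I,:]$. Assume that $B$ is $\varepsilon$-quasi-dominant. Then $$\|A-A_{\rm CUR}\|_F\le\left(1+(1+\varepsilon)\sqrt{mk}\right)\min_{X\in\mathbb{H}^{k\times n}}\|A-CX\|_F.$$
   Context: $\mathbb{H}$ is the skew field of real quaternions with modulus $|\cdot|$. $A[I,J]$, $A[:,J]$, $A[I,:]$ denote submatrices of $A$ with the indicated rows and columns. Nonsingular means having a two-sided inverse over $\mathbb{H}$. $\|M\|_F=(\sum_{i,j}|M_{ij}|^2)^{1/2}$ is the Frobenius norm. A nonsingular core $B=A[I,J]\in\mathbb{H}^{k\times k}$ is called $\varepsilon$-quasi-dominant if, with $C_B=A[:,J]B^{-1}\in\mathbb{H}^{m\times k}$ and $R_B=B^{-1}A[I,:]\in\mathbb{H}^{k\times n}$, one has $\max_{i,j}|(C_B)_{ij}|\le 1+\varepsilon$ and $\max_{i,j}|(R_B)_{ij}|\le 1+\varepsilon$. *)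

(* Defs.v *)
(* MathComp-Analysis; the real field is an arbitrary [R : realType]. *)
From HB Require Import structures.
From mathcomp Require Import all_boot all_order all_algebra.
From mathcomp Require Import ring.
From mathcomp Require Import classical_sets reals.

Set Implicit Arguments.
Unset Strict Implicit.
Unset Printing Implicit Defensive.

Import Order.TTheory GRing.Theory Num.Theory.
Local Open Scope ring_scope.

(* [Quat a b c d] is a + b i + c j + d k. *)
Record quat (R : Type) : Type := Quat { qre : R; qi : R; qj : R; qk : R }.

Section QuatChoice.
Variable R : choiceType.

Definition quat_tuple (x : quat R) : R * R * R * R :=
  (qre x, qi x, qj x, qk x).
Definition tuple_quat (t : R * R * R * R) : quat R :=
  let: (a, b, c, d) := t in Quat a b c d.
Lemma quat_tupleK : cancel quat_tuple tuple_quat.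
Proof. by case. Qed.

HB.instance Definition _ := Choice.copy (quat R) (can_type quat_tupleK).
End QuatChoice.

Section QuatRing.
Variable R : realFieldType.
Implicit Types x y z : quat R.

Definition quat_zero : quat R := Quat 0 0 0 0.
Definition quat_one : quat R := Quat 1 0 0 0.
Definition quat_opp x := Quat (- qre x) (- qi x) (- qj x) (- qk x).
Definition quat_add x y :=
  Quat (qre x + qre y) (qi x + qi y) (qj x + qj y) (qk x + qk y).
(* Hamilton's rules i^2 = j^2 = k^2 = ijk = -1. *)
Definition quat_mul x y :=
  Quat (qre x * qre y - qi x * qi y - qj x * qj y - qk x * qk y)
       (qre x * qi y + qi x * qre y + qj x * qk y - qk x * qj y)
       (qre x * qj y - qi x * qk y + qj x * qre y + qk x * qi y)
       (qre x * qk y + qi x * qj y - qj x * qi y + qk x * qre y).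

Lemma quat_addA : associative quat_add.
Proof. by move=> [????] [????] [????]; rewrite /quat_add /= !addrA. Qed.
Lemma quat_addC : commutative quat_add.
Proof. by move=> [????] [????]; congr Quat; rewrite /= addrC. Qed.
Lemma quat_add0 : left_id quat_zero quat_add.
Proof. by move=> [????]; rewrite /quat_add /= !add0r. Qed.
Lemma quat_addN : left_inverse quat_zero quat_opp quat_add.
Proof. by move=> [????]; rewrite /quat_add /= !addNr. Qed.

HB.instance Definition _ :=
  GRing.isZmodule.Build (quat R) quat_addA quat_addC quat_add0 quat_addN.

Lemma quat_mulA : associative quat_mul.
Proof. by move=> [????] [????] [????]; congr Quat => /=; ring. Qed.
Lemma quat_mul1l : left_id quat_one quat_mul.
Proof. by move=> [????]; rewrite /quat_mul /=; congr Quat; ring. Qed.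
Lemma quat_mul1r : right_id quat_one quat_mul.
Proof. by move=> [????]; rewrite /quat_mul /=; congr Quat; ring. Qed.
Lemma quat_mulDl : left_distributive quat_mul quat_add.
Proof. by move=> [????] [????] [????]; congr Quat => /=; ring. Qed.
Lemma quat_mulDr : right_distributive quat_mul quat_add.
Proof. by move=> [????] [????] [????]; congr Quat => /=; ring. Qed.
Lemma quat_one_neq0 : quat_one != quat_zero.
Proof. by apply/eqP => -[] /eqP; rewrite oner_eq0. Qed.

HB.instance Definition _ := GRing.Zmodule_isNzRing.Build (quat R)
  quat_mulA quat_mul1l quat_mul1r quat_mulDl quat_mulDr quat_one_neq0.

Definition quat_normsq x : R :=
  qre x ^+ 2 + qi x ^+ 2 + qj x ^+ 2 + qk x ^+ 2.
Definition quat_inv x : quat R :=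
  let n := quat_normsq x in
  Quat (qre x / n) (- qi x / n) (- qj x / n) (- qk x / n).
Definition quat_unit : pred (quat R) := fun x => x != 0.

Lemma quat_normsq_eq0 x : (quat_normsq x == 0) = (x == 0).
Proof.
apply/idP/eqP => [|->]; last by rewrite /quat_normsq /= expr0n /= !addr0.
case: x => a b c d.
rewrite /quat_normsq /= !paddr_eq0 ?addr_ge0 ?sqr_ge0 // !sqrf_eq0.
by move=> /andP[/andP[/andP[/eqP-> /eqP->] /eqP->] /eqP->].
Qed.

Lemma quat_mulVx : {in quat_unit, left_inverse 1 quat_inv *%R}.
Proof.
move=> x; rewrite unfold_in -quat_normsq_eq0; case: x => a b c d.
rewrite /quat_normsq /= => n0.
change (quat_mul (quat_inv (Quat a b c d)) (Quat a b c d) = Quat 1 0 0 0).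
by rewrite /quat_mul /quat_inv /quat_normsq /=; congr Quat; field.
Qed.
Lemma quat_mulxV : {in quat_unit, right_inverse 1 quat_inv *%R}.
Proof.
move=> x; rewrite unfold_in -quat_normsq_eq0; case: x => a b c d.
rewrite /quat_normsq /= => n0.
change (quat_mul (Quat a b c d) (quat_inv (Quat a b c d)) = Quat 1 0 0 0).
by rewrite /quat_mul /quat_inv /quat_normsq /=; congr Quat; field.
Qed.
Lemma quat_unitP x y : y * x = 1 /\ x * y = 1 -> quat_unit x.
Proof.
move=> [yx _]; apply/eqP => x0; move: yx; rewrite x0 mulr0 => /eqP.
by rewrite eq_sym oner_eq0.
Qed.
Lemma quat_inv_out : {in [predC quat_unit], quat_inv =1 id}.
Proof.
move=> x; rewrite inE /= unfold_in negbK => /eqP->.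
by rewrite /quat_inv /= !oppr0 !mul0r.
Qed.

HB.instance Definition _ := GRing.NzRing_hasMulInverse.Build (quat R)
  quat_mulVx quat_mulxV quat_unitP quat_inv_out.

End QuatRing.

Section Modulus.
Variable R : realType.

Definition qmod (x : quat R) : R := Num.sqrt (quat_normsq x).

Definition frobenius m n (M : 'M[quat R]_(m, n)) : R :=
  Num.sqrt (\sum_i \sum_j qmod (M i j) ^+ 2).

(* The default 0 only matters for matrices without entries. *)
Definition max_entry m n (M : 'M[quat R]_(m, n)) : R :=
  \big[Num.max/0]_i \big[Num.max/0]_j qmod (M i j).

End Modulus.

(* [unitmx] and [invmx] require a commutative ring, hence these versions. *)
Section Inverse.
Variables (S : nzRingType) (k : nat).

Definition inverse_of (B B' : 'M[S]_k) : Prop :=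
  B *m B' = 1%:M /\ B' *m B = 1%:M.
Definition nonsingular (B : 'M[S]_k) : Prop := exists B', inverse_of B B'.
Definition matinv (B : 'M[S]_k) : 'M[S]_k :=
  xget 0 [set B' | inverse_of B B']%classic.

Lemma matinvP (B : 'M[S]_k) : nonsingular B -> inverse_of B (matinv B).
Proof.
exact: (xgetPex (0 : 'M[S]_k)).
Qed.

Lemma inverse_of_uniq (B B1 B2 : 'M[S]_k) :
  inverse_of B B1 -> inverse_of B B2 -> B1 = B2.
Proof.
by move=> [_ h1] [h2 _]; rewrite -[B1]mulmx1 -h2 mulmxA h1 mul1mx.
Qed.

End Inverse.

(* The increasing enumeration of an index set of cardinality k. *)
Definition set_index m k (I : {set 'I_m}) (hI : #|I| = k) (r : 'I_k) : 'I_m :=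
  enum_val (cast_ord (esym hI) r).

Section Submatrices.
Variables (R : realType) (m n k : nat) (A : 'M[quat R]_(m, n)).
Variables (I : {set 'I_m}) (J : {set 'I_n}) (hI : #|I| = k) (hJ : #|J| = k).

Definition subcols : 'M[quat R]_(m, k) := colsub (set_index hJ) A.
Definition subrows : 'M[quat R]_(k, n) := rowsub (set_index hI) A.
Definition core : 'M[quat R]_k := mxsub (set_index hI) (set_index hJ) A.

Definition cur : 'M[quat R]_(m, n) := subcols *m matinv core *m subrows.

Definition quasi_dominant (eps : R) : Prop :=
  [/\ nonsingular core,
      max_entry (subcols *m matinv core) <= 1 + eps
    & max_entry (matinv core *m subrows) <= 1 + eps].

End Submatrices.

Definition is_minimum (R : realType) (S : set R) (mu : R) : Prop :=
  S mu /\ lbound S mu.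

(* Main.v *)
(** The least-squares problem has a solution because [A] can be projected
    orthogonally, one column of [C] at a time (Gram-Schmidt over the skew field),
    onto the matrices [C X]. The estimate holds for every [X]: with
    [E = A - C X] one has [A - A_CUR = E - C B^-1 E[I,:]], and every entry of
    [C B^-1] has modulus at most [1 + eps]. *)
From HB Require Import structures.
Require Import Defs.
From mathcomp Require Import all_boot all_order all_algebra.
From mathcomp Require Import ring.
From mathcomp Require Import classical_sets reals.
Import Order.TTheory GRing.Theory Num.Theory.
Local Open Scope ring_scope.

Set Implicit Arguments.
Unset Strict Implicit.
Unset Printing Implicit Defensive.

(** * Cauchy-Schwarz and Minkowski for finite real sums *)

Section RealSums.
Variable R : rcfType.

Lemma sum_cauchy_schwarz (T : finType) (a b : T -> R) :
  (\sum_t a t * b t) ^+ 2 <= (\sum_t a t ^+ 2) * (\sum_t b t ^+ 2).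
Proof.
set p := \sum_t a t * b t; set q := \sum_t a t ^+ 2; set r := \sum_t b t ^+ 2.
have r0 : 0 <= r by apply: sumr_ge0 => t _; exact: sqr_ge0.
have quad x y : 0 <= x ^+ 2 * q - 2 * x * y * p + y ^+ 2 * r.
  have -> : x ^+ 2 * q - 2 * x * y * p + y ^+ 2 * r =
            \sum_t (x * a t - y * b t) ^+ 2.
    rewrite !mulr_sumr -sumrB -big_split /=.
    by apply: eq_bigr => t _; ring.
  by apply: sumr_ge0 => t _; exact: sqr_ge0.
have [r_eq0 | r_neq0] := eqVneq r 0; last first.
  have rgt0 : 0 < r by rewrite lt_neqAle eq_sym r_neq0.
  (* The choice [x = r], [y = p] makes the form equal to [r * (q * r - p ^+ 2)], and [r > 0] can be
     cancelled. *)
  have := quad r p.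
  have -> : r ^+ 2 * q - 2 * r * p * p + p ^+ 2 * r = r * (q * r - p ^+ 2) by ring.
  by rewrite pmulr_rge0 // subr_ge0.
have b0 t : b t = 0.
  apply/eqP; rewrite -sqrf_eq0.
  by have := psumr_eq0P (fun t _ => sqr_ge0 (b t)) r_eq0 => /(_ t isT) ->.
by rewrite /p big1 ?expr0n ?mulr_ge0 // /q ?sumr_ge0 // => t _;
  rewrite ?b0 ?mulr0 ?sqr_ge0.
Qed.

Lemma sum_minkowski (T : finType) (a b : T -> R) :
  Num.sqrt (\sum_t (a t + b t) ^+ 2) <=
  Num.sqrt (\sum_t a t ^+ 2) + Num.sqrt (\sum_t b t ^+ 2).
Proof.
have q0 (c : T -> R) : 0 <= \sum_t c t ^+ 2.
  by apply: sumr_ge0 => t _; exact: sqr_ge0.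
rewrite -(@ler_pXn2r _ 2) // ?nnegrE ?addr_ge0 ?sqrtr_ge0 //.
rewrite sqrrD !sqr_sqrtr // -mulr_natl.
have -> : \sum_t (a t + b t) ^+ 2 =
    \sum_t a t ^+ 2 + 2 * \sum_t a t * b t + \sum_t b t ^+ 2.
  by rewrite mulr_sumr -!big_split; apply: eq_bigr => t _ /=; ring.
rewrite lerD2r lerD2l ler_pM2l // -sqrtrM //.
apply: le_trans (ler_norm _) _; rewrite -sqrtr_sqr.
exact/ler_wsqrtr/sum_cauchy_schwarz.
Qed.

End RealSums.

(** * Conjugation and modulus of quaternions *)

Section Quaternions.
Variable R : realType.
Implicit Types x y : quat R.

Definition qconj x : quat R := Quat (qre x) (- qi x) (- qj x) (- qk x).

Fact qre_is_zmod_morphism : zmod_morphism (@qre R).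
Proof. by move=> [????] [????]. Qed.
HB.instance Definition _ :=
  GRing.isZmodMorphism.Build (quat R) R (@qre R) qre_is_zmod_morphism.

Fact qconj_is_zmod_morphism : zmod_morphism qconj.
Proof. by move=> [????] [????]; congr Quat => /=; rewrite opprD. Qed.
HB.instance Definition _ :=
  GRing.isZmodMorphism.Build (quat R) (quat R) qconj qconj_is_zmod_morphism.

Lemma qconjM x y : qconj (x * y) = qconj y * qconj x.
Proof. by case: x y => [????] [????]; congr Quat => /=; ring. Qed.

Lemma qre_conjM x : qre (qconj x * x) = quat_normsq x.
Proof. by case: x => ????; rewrite /quat_normsq /=; ring. Qed.

Lemma quat_normsq_ge0 x : 0 <= quat_normsq x.
Proof. by rewrite /quat_normsq !addr_ge0 ?sqr_ge0. Qed.

(** Euler's four-square identity. *)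
Lemma quat_normsqM x y : quat_normsq (x * y) = quat_normsq x * quat_normsq y.
Proof. by case: x y => [????] [????]; rewrite /quat_normsq /=; ring. Qed.

(** Polarization: [qre (qconj x * y)] is the Euclidean inner product on R^4. *)
Lemma quat_normsqD x y :
  quat_normsq (x + y) =
  quat_normsq x + 2 * qre (qconj x * y) + quat_normsq y.
Proof. by case: x y => [????] [????]; rewrite /quat_normsq /=; ring. Qed.

Lemma qmod_ge0 x : 0 <= qmod x. Proof. exact: sqrtr_ge0. Qed.

Lemma sqr_qmod x : qmod x ^+ 2 = quat_normsq x.
Proof. by rewrite sqr_sqrtr ?quat_normsq_ge0. Qed.

Lemma qmodM x y : qmod (x * y) = qmod x * qmod y.
Proof. by rewrite /qmod quat_normsqM sqrtrM ?quat_normsq_ge0. Qed.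

Lemma qmod0 : qmod (0 : quat R) = 0.
Proof. by rewrite /qmod /quat_normsq /= expr0n !addr0 sqrtr0. Qed.

Lemma qmodN x : qmod (- x) = qmod x.
Proof. by rewrite /qmod /quat_normsq /= !sqrrN. Qed.

Lemma qmod_conj x : qmod (qconj x) = qmod x.
Proof. by rewrite /qmod /quat_normsq /= !sqrrN. Qed.

Lemma qre_le_qmod x : qre x <= qmod x.
Proof.
apply: le_trans (ler_norm _) _; rewrite -sqrtr_sqr.
by apply: ler_wsqrtr; rewrite /quat_normsq -!addrA lerDl !addr_ge0 ?sqr_ge0.
Qed.

Lemma qmodD x y : qmod (x + y) <= qmod x + qmod y.
Proof.
rewrite -(@ler_pXn2r _ 2) // ?nnegrE ?addr_ge0 ?qmod_ge0 //.
rewrite sqrrD !sqr_qmod quat_normsqD -[_ * _ *+ 2]mulr_natl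
  lerD2r lerD2l ler_pM2l //.
(* Cauchy-Schwarz in R^4 follows from multiplicativity of the modulus, since a real part never
   exceeds the modulus. *)
by rewrite -(qmod_conj x) -qmodM qre_le_qmod.
Qed.

Lemma qmod_sum (T : finType) (f : T -> quat R) :
  qmod (\sum_t f t) <= \sum_t qmod (f t).
Proof.
elim/big_ind2: _ => [|x a y b hx hy|//]; first by rewrite qmod0.
exact: le_trans (qmodD _ _) (lerD hx hy).
Qed.

End Quaternions.

Arguments qconj {R}.

(** * Adjoints, Frobenius norm and least squares over the quaternions *)

Section QuaternionMatrices.
Variable R : realType.

(** Conjugation reverses products, so the conjugate transpose still reverses matrix products over a
    noncommutative ring, where the plain transpose does not. *)
Definition adjmx m n (M : 'M[quat R]_(m, n)) : 'M[quat R]_(n, m) :=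
  map_mx qconj M^T.

Lemma adjmxM m n p (M : 'M[quat R]_(m, n)) (N : 'M[quat R]_(n, p)) :
  adjmx (M *m N) = adjmx N *m adjmx M.
Proof.
apply/matrixP => i j; rewrite !mxE raddf_sum; apply: eq_bigr => l _.
by rewrite !mxE /= qconjM.
Qed.

Lemma adjmxD m n (M N : 'M[quat R]_(m, n)) :
  adjmx (M + N) = adjmx M + adjmx N.
Proof. by rewrite /adjmx linearD map_mxD. Qed.

Lemma adjmx_row m n p (M : 'M[quat R]_(m, n)) (N : 'M[quat R]_(m, p)) :
  adjmx (row_mx M N) = col_mx (adjmx M) (adjmx N).
Proof. by rewrite /adjmx tr_row_mx map_col_mx. Qed.

Lemma frobeniusE m n (M : 'M[quat R]_(m, n)) :
  frobenius M = Num.sqrt (\sum_p qmod (M p.1 p.2) ^+ 2).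
Proof. by rewrite /frobenius pair_bigA. Qed.

Lemma frobenius_sum_ge0 m n (M : 'M[quat R]_(m, n)) :
  0 <= \sum_i \sum_j qmod (M i j) ^+ 2.
Proof. by do 2![apply: sumr_ge0 => ? _]; exact: sqr_ge0. Qed.

Lemma frobenius_ge0 m n (M : 'M[quat R]_(m, n)) : 0 <= frobenius M.
Proof. exact: sqrtr_ge0. Qed.

Lemma sqr_frobenius m n (M : 'M[quat R]_(m, n)) :
  frobenius M ^+ 2 = \sum_i \sum_j qmod (M i j) ^+ 2.
Proof. by rewrite sqr_sqrtr ?frobenius_sum_ge0. Qed.

Lemma sqr_frobenius_tr m n (M : 'M[quat R]_(m, n)) :
  frobenius M ^+ 2 = qre (\tr (adjmx M *m M)).
Proof.
rewrite sqr_frobenius exchange_big raddf_sum; apply: eq_bigr => j _.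
rewrite mxE raddf_sum; apply: eq_bigr => i _.
by rewrite !mxE sqr_qmod -qre_conjM.
Qed.

Lemma frobenius_eq0 m n (M : 'M[quat R]_(m, n)) : frobenius M = 0 -> M = 0.
Proof.
move=> M0; apply/matrixP => i j; rewrite mxE; apply/eqP.
have := sqr_frobenius M; rewrite M0 expr0n /= => /esym.
rewrite pair_bigA /= => /psumr_eq0P M0'.
rewrite -quat_normsq_eq0 -sqr_qmod.
by rewrite (M0' _ (i, j) isT) // => p _; exact: sqr_ge0.
Qed.

Lemma adjmx_mul_eq0 m n (M : 'M[quat R]_(m, n)) : adjmx M *m M = 0 -> M = 0.
Proof.
move=> MM; apply: frobenius_eq0; apply/eqP; rewrite -sqrf_eq0.
by rewrite sqr_frobenius_tr MM raddf0.
Qed.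

Lemma frobeniusD m n (M N : 'M[quat R]_(m, n)) :
  frobenius (M + N) <= frobenius M + frobenius N.
Proof.
rewrite !frobeniusE; apply: le_trans (sum_minkowski _ _).
apply/ler_wsqrtr/ler_sum => p _.
by rewrite mxE ler_pXn2r ?nnegrE ?addr_ge0 ?qmod_ge0 // qmodD.
Qed.

Lemma frobeniusN m n (M : 'M[quat R]_(m, n)) : frobenius (- M) = frobenius M.
Proof.
by rewrite !frobeniusE; congr Num.sqrt; apply: eq_bigr => p _; rewrite mxE qmodN.
Qed.

Lemma frobenius_pythagoras m n (E F : 'M[quat R]_(m, n)) :
  adjmx F *m E = 0 ->
  frobenius (E + F) ^+ 2 = frobenius E ^+ 2 + frobenius F ^+ 2.
Proof.
(* The second cross term is the adjoint of the first, because taking adjoints is an involution. *)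
move=> FE; have EF : adjmx E *m F = 0.
  have -> : F = adjmx (adjmx F).
    by apply/matrixP => i j; rewrite !mxE; case: (F i j) => ????;
       rewrite /qconj /= !opprK.
  by rewrite -adjmxM FE; apply/matrixP => i j; rewrite !mxE raddf0.
rewrite !sqr_frobenius_tr adjmxD mulmxDl !mulmxDr FE EF addr0 add0r.
by rewrite !raddfD.
Qed.

(** Induction on the columns of [C]: the first column is reduced to its part [d] orthogonal to the
    others, and a residual already orthogonal to those is corrected along [d] alone. *)
Lemma orthogonal_residual_exists m n k
    (C : 'M[quat R]_(m, k)) (A : 'M[quat R]_(m, n)) :
  exists X, adjmx C *m (A - C *m X) = 0.
Proof.
(* [n] varies because the hypothesis is applied both to [A] and to a single column. *)
elim: k => [|k IHk] in n C A *.
  by exists 0; apply/matrixP => -[].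
rewrite -[C](@hsubmxK _ m 1 k).
move: (lsubmx _) (rsubmx _) => c C'.
have [Y CY] := IHk _ C' c; have [X CX] := IHk _ C' A.
set d := c - C' *m Y in CY; set E := A - C' *m X in CX.
have cE : c = C' *m Y + d by rewrite addrC subrK.
suff [t dE] : exists t, adjmx d *m (E - d *m t) = 0.
  (* Chosen so that [c t + C' (X - Y t) = C' X + d t]. *)
  exists (col_mx t (X - Y *m t)).
  have -> : A - row_mx c C' *m col_mx t (X - Y *m t) = E - d *m t.
    rewrite mul_row_col mulmxBr /E /d mulmxBl mulmxA !opprB !opprD !opprK.
    by rewrite -!addrA; congr (_ + _); rewrite [RHS]addrA addrC.
  have C'E : adjmx C' *m (E - d *m t) = 0.
    by rewrite mulmxBr CX mulmxA CY mul0mx subr0.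
  rewrite (adjmx_row c C') (mul_col_mx (adjmx c)) C'E {1}cE adjmxD
    adjmxM mulmxDl dE -mulmxA C'E.
  by rewrite mulmx0 addr0 col_mx0.
(* If [d = 0], the column [c] already lies in the span of [C'] and needs no correction. *)
have [d0 | d_neq0] := eqVneq d 0.
  by exists 0; rewrite d0 /adjmx trmx0 map_mx0 mul0mx.
set s := (adjmx d *m d) 0 0.
have ddE : adjmx d *m d = s%:M by exact: mx11_scalar.
have s_unit : s \is a GRing.unit.
  change (s != 0); apply: contra_neq d_neq0 => s0.
  by apply: adjmx_mul_eq0; rewrite ddE s0 raddf0.
(* The projection coefficients along [d]; [s^-1] stands on the left to cancel
   [adjmx d *m d = s%:M]. *)
exists (s^-1%:M *m (adjmx d *m E)).
by rewrite mulmxBr !mulmxA ddE -scalar_mxM divrr // mul1mx subrr.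
Qed.

Lemma least_squares_exists m n k
    (C : 'M[quat R]_(m, k)) (A : 'M[quat R]_(m, n)) :
  exists X, forall Y, frobenius (A - C *m X) <= frobenius (A - C *m Y).
Proof.
have [X CX] := orthogonal_residual_exists C A; exists X => Y.
rewrite -(@ler_pXn2r _ 2) // ?nnegrE ?frobenius_ge0 //.
have -> : A - C *m Y = A - C *m X + C *m (X - Y).
  by rewrite mulmxBr addrA subrK.
(* The residual at [X] is orthogonal to every [C *m Z], so moving from [X] to [Y] only adds a
   square. *)
rewrite [leRHS]frobenius_pythagoras ?lerDl ?sqr_ge0 //.
by rewrite adjmxM -mulmxA CX mulmx0.
Qed.

Lemma max_entry_ge0 m n (M : 'M[quat R]_(m, n)) : 0 <= max_entry M.
Proof. exact: bigmax_ge_id. Qed.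

Lemma qmod_le_max_entry m n (M : 'M[quat R]_(m, n)) i j :
  qmod (M i j) <= max_entry M.
Proof.
apply: le_trans (le_bigmax _ _ i).
exact: (le_bigmax _ (fun j => qmod (M i j)) j).
Qed.

(** Each entry of the product is at most [max_entry M] times the l1 norm of a column of [N]; passing
    to l2 costs [k] in the squares, and summing over the rows costs [m]. *)
Lemma frobenius_mul_le m k n (M : 'M[quat R]_(m, k)) (N : 'M[quat R]_(k, n)) :
  frobenius (M *m N) <= max_entry M * Num.sqrt (m * k)%:R * frobenius N.
Proof.
have mkN : 0 <= max_entry M * Num.sqrt (m * k)%:R * frobenius N.
  by rewrite !mulr_ge0 ?max_entry_ge0 ?sqrtr_ge0.
rewrite -(@ler_pXn2r _ 2) // ?nnegrE ?frobenius_ge0 //.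
rewrite !exprMn !sqr_frobenius sqr_sqrtr ?ler0n // natrM.
have entry i j : qmod ((M *m N) i j) ^+ 2 <=
    max_entry M ^+ 2 * (k%:R * \sum_l qmod (N l j) ^+ 2).
  have le1 : qmod ((M *m N) i j) <= max_entry M * \sum_l qmod (N l j).
    rewrite mxE mulr_sumr; apply: le_trans (qmod_sum _) _.
    apply: ler_sum => l _.
    by rewrite qmodM ler_wpM2r ?qmod_ge0 ?qmod_le_max_entry.
  apply: (@le_trans _ _ ((max_entry M * \sum_l qmod (N l j)) ^+ 2)).
    by rewrite ler_pXn2r ?nnegrE ?qmod_ge0 // (le_trans (qmod_ge0 _) le1).
  rewrite exprMn ler_wpM2l ?sqr_ge0 //.
  (* Pairing with the constant vector 1 produces the factor [k]. *)
  have := sum_cauchy_schwarz (fun=> 1) (fun l => qmod (N l j)).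
  under eq_bigr do rewrite mul1r.
  by under [X in X * _]eq_bigr do rewrite expr1n; rewrite sumr_const card_ord.
apply: le_trans (ler_sum _ (fun i _ => ler_sum _ (fun j _ => entry i j))) _.
rewrite sumr_const card_ord -!mulr_sumr [X in k%:R * X]exchange_big /=.
by rewrite -mulr_natl le_eqVlt; apply/orP; left; apply/eqP; ring.
Qed.

(** Injectivity means that no row is counted twice, so the left side is a partial sum of nonnegative
    terms. *)
Lemma frobenius_rowsub_le m n k (f : 'I_k -> 'I_m) (M : 'M[quat R]_(m, n)) :
  injective f -> frobenius (rowsub f M) <= frobenius M.
Proof.
move=> f_inj; apply: ler_wsqrtr.
under eq_bigr do under eq_bigr do rewrite mxE.
rewrite -(big_imset (fun i => \sum_j qmod (M i j) ^+ 2) (A := 'I_k)) /=; last first.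
  by move=> x y _ _; exact: f_inj.
rewrite [leRHS](bigID (mem (f @: 'I_k))) /= lerDl.
by do 2![apply: sumr_ge0 => ? _]; exact: sqr_ge0.
Qed.

End QuaternionMatrices.

(** * The estimate for the CUR approximation *)

Lemma set_index_inj m k (I : {set 'I_m}) (hI : #|I| = k) :
  injective (set_index hI).
Proof. by move=> r s /enum_val_inj /cast_ord_inj. Qed.

Theorem corollary2 (R : realType) (m n k : nat) (A : 'M[quat R]_(m, n))
    (I : {set 'I_m}) (J : {set 'I_n}) (hI : #|I| = k) (hJ : #|J| = k)
    (eps : R) (hB : nonsingular (core A hI hJ))
    (hdom : quasi_dominant A hI hJ eps) :
  exists mu : R,
    is_minimum
      [set frobenius (A - subcols A hJ *m X) | X in [set: 'M[quat R]_(k, n)]]%classic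
      mu /\
    frobenius (A - cur A hI hJ) <=
      (1 + (1 + eps) * Num.sqrt (m * k)%:R) * mu.
Proof.
have [X minX] := least_squares_exists (subcols A hJ) A.
exists (frobenius (A - subcols A hJ *m X)); split.
  by split=> [|_ [Y _ <-]]; [exists X | exact: minX].
have [_ domC _] := hdom; have [_ VB] := matinvP hB.
set C := subcols A hJ in minX domC *; set E := A - C *m X.
set V := matinv _ in domC VB.
(* The selected rows of [E] are [A[I,:] - B X], and [V B = 1] turns [C V B X] into [C X], which
   cancels. *)
have -> : A - cur A hI hJ = E - C *m V *m rowsub (set_index hI) E.
  have -> : rowsub (set_index hI) E = subrows A hI - core A hI hJ *m X.
    apply/matrixP => i j; rewrite !mxE; congr (_ - _).
    by apply: eq_bigr => l _; rewrite !mxE.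
  by rewrite mulmxBr (mulmxA (C *m V)) -(mulmxA C V (core A hI hJ)) VB mulmx1
    /E opprB addrA subrK.
apply: le_trans (frobeniusD _ _) _.
rewrite frobeniusN mulrDl mul1r lerD2l.
apply: le_trans (frobenius_mul_le _ _) _.
(* Quasi-dominance bounds the factor from [C *m V]; row selection does not increase the norm of
   [E]. *)
apply: ler_pM; rewrite ?mulr_ge0 ?max_entry_ge0 ?sqrtr_ge0 ?frobenius_ge0 //.
  by rewrite ler_wpM2r ?sqrtr_ge0.
exact/frobenius_rowsub_le/set_index_inj.
Qed.
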